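(* Let $1\to N\to G\xrightarrow{\pi}Q\to1$ be a short exact sequence of groups, $M$ a $G$-module, and $\alpha:Q\to G$ a section of $\pi$ with factor set $f_\alpha:Q\times Q\to N$, i.e. $\alpha(q)\alpha(q')=f_\alpha(q,q')\alpha(qq')$. Let $d:N\to M$ be a derivation with $[d]\in H^1(N,M)^Q$, and let $\eta:Q\to M$ be a normalized map (i.e. $\eta(1)=0$) such that $({}^{\alpha(q)}d-d)(n)=n\cdot\eta(q)-\eta(q)$ for all $q\in Q$, $n\in N$. Then $\mathrm{tr}[d]\in H^2(Q,M^N)$ is represented by the cocycle $F:Q\times Q\to M^N$, $$F(q_1,q_2)=\eta(q_1)+\alpha(q_1)\cdot\eta(q_2)-f_\alpha(q_1,q_2)\cdot\eta(q_1q_2)-d(f_\alpha(q_1,q_2)).$$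
   Context: $N$ is regarded as a normal subgroup of $G$; $M$ is written additively. $M\rtimes G$ has law $(m,g)(m',g')=(m+g\cdot m',gg')$. $H^1(N,M)=\mathrm{Der}(N,M)/\mathrm{Inn}(N,M)$, with $G$-action on derivations $({}^gd)(n)=g\cdot d(g^{-1}ng)$, inducing a $Q$-module structure on $H^1(N,M)$. The map $\mathrm{tr}:H^1(N,M)^Q\to H^2(Q,M^N)$ sends $[d]$ to the class of the extension $0\to M^N\xrightarrow{\overline i}N_{M\rtimes G}(H)/H\to Q\to1$, where $H=\{(d(n),n)\mid n\in N\}$, $\overline i(m)=(m,1)H$, and the second map is induced by $(m,g)\mapsto\pi(g)$. The cocycle $F$ of an extension $0\to A\xrightarrow{\iota}E\to Q\to 1$ with respect to a section $\sigma:Q\to E$ is given by $\sigma(q_1)\sigma(q_2)=\iota(F(q_1,q_2))\,\sigma(q_1q_2)$. *)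

(* Defs.v *)
From HB Require Import structures.
From mathcomp Require Import all_boot all_algebra.
From mathcomp Require Import generic_quotient ring_quotient.
From mathcomp Require Import boolp functions.

Set Implicit Arguments.
Unset Strict Implicit.
Unset Printing Implicit Defensive.

Import GRing.Theory.

(* In this order, [*], [1], [^-1] and [^] are group operations and [+], [-],
   [0] are module operations. *)
Local Open Scope quotient_scope.
Local Open Scope ring_scope.
Local Open Scope group_scope.

Reserved Notation "g *> m" (at level 40, left associativity).

HB.mixin Record isGModule (G : groupType) M of GRing.Zmodule M := {
  gact : G -> M -> M;
  gact1 : forall m, gact 1 m = m;
  gactM : forall g h m, gact (g * h) m = gact g (gact h m);
  gactD : forall g m m', gact g (m + m') = gact g m + gact g m'
}.

#[short(type="gmodType")]
HB.structure Definition GModule (G : groupType) :=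
  {M of GRing.Zmodule M & isGModule G M}.

Notation "g *> m" := (gact g m) : group_scope.

Section GModuleTheory.
Variables (G : groupType) (M : gmodType G).
Implicit Types (g h : G) (m : M).

Lemma gact0 g : g *> (0 : M) = 0.
Proof. by apply: (addrI (g *> (0 : M))); rewrite -gactD !addr0. Qed.

Lemma gactN g m : g *> (- m) = - (g *> m).
Proof. by apply: (addrI (g *> m)); rewrite -gactD !subrr gact0. Qed.

Lemma gactB g m m' : g *> (m - m') = g *> m - g *> m'.
Proof. by rewrite gactD gactN. Qed.

Lemma gactK g m : g^-1 *> (g *> m) = m.
Proof. by rewrite -gactM mulVg gact1. Qed.

Lemma gactVK g m : g *> (g^-1 *> m) = m.
Proof. by rewrite -gactM mulgV gact1. Qed.

Lemma gact_inj g : injective (@gact G M g).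
Proof. exact: can_inj (gactK g). Qed.
End GModuleTheory.

Lemma morph1 (G H : groupType) (f : {multiplicative G -> H}) : f 1 = 1.
Proof. by apply: (mulgI (f 1)); rewrite -gmulfM !mulg1. Qed.

Lemma morphV (G H : groupType) (f : {multiplicative G -> H}) :
  {morph f : x / x^-1}.
Proof. by move=> x; apply: (mulgI (f x)); rewrite -gmulfM !mulgV morph1. Qed.

Section H2.
Variables (Q : groupType) (A : gmodType Q).

(* Inhomogeneous 2-cocycles of the left module [A], not assumed normalized. *)
Definition is_cocycle2 (F : Q -> Q -> A) : Prop := forall q1 q2 q3,
  q1 *> F q2 q3 + F q1 (q2 * q3) = F (q1 * q2) q3 + F q1 q2.

Definition cocycle2_pred : {pred Q -> Q -> A} := fun F => `[< is_cocycle2 F >].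

Lemma cocycle2_closed : zmod_closed cocycle2_pred.
Proof.
split=> [|F F' /asboolP FZ /asboolP F'Z]; apply/asboolP => q1 q2 q3.
  by rewrite gact0 !addr0.
by rewrite !fctE gactB addrACA -opprD FZ F'Z opprD addrACA.
Qed.

HB.instance Definition _ :=
  GRing.isZmodClosed.Build (Q -> Q -> A) cocycle2_pred cocycle2_closed.

Record cocycle2 := Cocycle2 {
  cocycle2_fun :> Q -> Q -> A;
  cocycle2_mem : cocycle2_fun \in cocycle2_pred
}.

HB.instance Definition _ := [isSub for cocycle2_fun].
HB.instance Definition _ := [Choice of cocycle2 by <:].
HB.instance Definition _ := [SubChoice_isSubZmodule of cocycle2 by <:].

Lemma cocycle2P (F : cocycle2) : is_cocycle2 F.
Proof. by apply/asboolP/cocycle2_mem. Qed.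

Lemma cocycle2B (F F' : cocycle2) q1 q2 : (F - F') q1 q2 = F q1 q2 - F' q1 q2.
Proof. by rewrite -[cocycle2_fun _]/(val _) raddfB. Qed.

Definition is_coboundary2 (F : Q -> Q -> A) : Prop :=
  exists h : Q -> A, forall q1 q2,
    F q1 q2 = q1 *> h q2 - h (q1 * q2) + h q1.

Definition coboundary2 : {pred cocycle2} := fun F => `[< is_coboundary2 F >].

Lemma coboundary2_closed : zmod_closed coboundary2.
Proof.
split=> [|F F' /asboolP[h Fh] /asboolP[h' F'h]]; apply/asboolP.
  by exists (fun=> 0) => q1 q2; rewrite gact0 subrr addr0.
exists (fun q => h q - h' q) => q1 q2.
rewrite cocycle2B.
rewrite Fh F'h gactB opprD addrACA; congr (_ + _).
by rewrite [in LHS]opprD [LHS]addrACA -opprD.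
Qed.

HB.instance Definition _ :=
  GRing.isZmodClosed.Build cocycle2 coboundary2 coboundary2_closed.

Definition H2 := {ideal_quot coboundary2}.
HB.instance Definition _ := GRing.Zmodule.on H2.

Definition H2class (F : cocycle2) : H2 := \pi F.

Lemma H2class_eq (F F' : cocycle2) :
  H2class F = H2class F' <-> is_coboundary2 (F - F').
Proof.
split=> [/eqP|] FF'; last apply/eqP; move: FF'; rewrite -Quotient.idealrBE.
  by move/asboolP.
by move=> FF'; apply/asboolP.
Qed.
End H2.

Arguments cocycle2_pred {Q} A _.
Arguments coboundary2 {Q} A _.
Arguments H2 {Q} A.

Section Extensions.
Variables (Q : groupType) (A : gmodType Q).

(* Extensions [0 -> A -> E -> Q -> 1] inducing the given action of [Q] on
   [A]. *)
Record extension := Extension {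
  ext_group : groupType;
  ext_i : A -> ext_group;
  ext_p : {multiplicative ext_group -> Q};
  ext_iD : forall a b, ext_i (a + b) = ext_i a * ext_i b;
  ext_i_inj : injective ext_i;
  ext_exact : forall x, ext_p x = 1 <-> exists a, x = ext_i a;
  ext_p_surj : forall q, exists x, ext_p x = q;
  ext_act : forall x a, ext_i (ext_p x *> a) = x * ext_i a * x^-1
}.

Variable X : extension.
Implicit Types s : Q -> ext_group X.

Lemma ext_fiber (x y : ext_group X) :
  ext_p X x = ext_p X y -> exists a, x = ext_i X a * y.
Proof.
move=> pxy; have /ext_exact[a xy] : ext_p X (x * y^-1) = 1.
  by rewrite gmulfM morphV pxy mulgV.
by exists a; rewrite -xy mulgVK.
Qed.

Section Section.
Variables (s : Q -> ext_group X) (sK : cancel s (ext_p X)).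

Lemma ext_cocycle_ex q1 q2 :
  exists a, s q1 * s q2 = ext_i X a * s (q1 * q2).
Proof. by apply: ext_fiber; rewrite gmulfM !sK. Qed.

(* [s q1 * s q2 = ext_i (F q1 q2) * s (q1 * q2)]. *)
Definition ext_cocycle_fun q1 q2 : A := sval (cid (ext_cocycle_ex q1 q2)).

Lemma ext_cocycle_funE q1 q2 :
  s q1 * s q2 = ext_i X (ext_cocycle_fun q1 q2) * s (q1 * q2).
Proof. exact: svalP (cid (ext_cocycle_ex q1 q2)). Qed.

Lemma ext_cocycle_subproof : ext_cocycle_fun \in cocycle2_pred A.
Proof.
apply/asboolP => q1 q2 q3; apply/(@ext_i_inj X)/(mulIg (s (q1 * q2 * q3))).
transitivity (s q1 * s q2 * s q3).
  rewrite ext_iD -[LHS]mulgA -[in s _]mulgA -ext_cocycle_funE.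
  rewrite -{1}(sK q1) ext_act -!mulgA mulKg; congr (_ * _).
  by rewrite -ext_cocycle_funE.
rewrite [in RHS]addrC ext_iD -[RHS]mulgA -ext_cocycle_funE.
by rewrite [RHS]mulgA -ext_cocycle_funE.
Qed.

Definition ext_cocycle : cocycle2 A := Cocycle2 ext_cocycle_subproof.
End Section.

Definition ext_section q := sval (cid (ext_p_surj X q)).

Lemma ext_sectionK : cancel ext_section (ext_p X).
Proof. by move=> q; apply: svalP (cid (ext_p_surj X q)). Qed.

Definition ext_class : H2 A := H2class (ext_cocycle ext_sectionK).

Lemma ext_classE s (sK : cancel s (ext_p X)) :
  ext_class = H2class (ext_cocycle sK).
Proof.
apply/H2class_eq.
have sE q : exists a, ext_section q = ext_i X a * s q.
  by apply: ext_fiber; rewrite ext_sectionK sK.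
pose h q := sval (cid (sE q)).
have hE q : ext_section q = ext_i X (h q) * s q by exact: svalP (cid (sE q)).
exists h => q1 q2; rewrite cocycle2B /=.
set F := ext_cocycle_fun ext_sectionK q1 q2; set F' := ext_cocycle_fun sK q1 q2.
suff FE : F + h (q1 * q2) = q1 *> h q2 + h q1 + F'.
  by rewrite -(addrK (h (q1 * q2)) F) FE addrAC addrK addrAC.
apply/(@ext_i_inj X)/(mulIg (s (q1 * q2))).
rewrite ext_iD -[LHS]mulgA -hE -ext_cocycle_funE !hE.
rewrite [_ + h q1]addrC !ext_iD -!mulgA -ext_cocycle_funE.
have -> : q1 *> h q2 = ext_p X (s q1) *> h q2 by rewrite sK.
by rewrite ext_act -!mulgA mulKg.
Qed.
End Extensions.

Lemma ext_class_equiv (Q : groupType) (A : gmodType Q) (X Y : extension A)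
    (phi : {multiplicative ext_group X -> ext_group Y}) :
    (forall a, phi (ext_i X a) = ext_i Y a) ->
    (forall x, ext_p Y (phi x) = ext_p X x) ->
  ext_class X = ext_class Y.
Proof.
move=> phii phip; have sK : cancel (phi \o @ext_section _ _ X) (ext_p Y).
  by move=> q /=; rewrite phip ext_sectionK.
rewrite (ext_classE sK); congr H2class; apply: val_inj.
apply/funext => q1; apply/funext => q2 /=; apply: (@ext_i_inj _ _ Y).
apply: (mulIg (phi (@ext_section _ _ X (q1 * q2)))).
rewrite -phii -gmulfM -ext_cocycle_funE gmulfM.
exact: (ext_cocycle_funE sK).
Qed.

Section NormalizerQuotient.
Variables (E : groupType) (H : groupClosed E).

Definition normalizer : {pred E} :=
  fun x => `[< forall h, (h ^ x \in H) = (h \in H) >].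

Lemma normalizer_closed : group_closed normalizer.
Proof.
split=> [|x y /asboolP xN /asboolP yN]; apply/asboolP => h.
  by rewrite conjg1.
by rewrite conjgM -[LHS]yN -conjgM mulVg conjg1 xN.
Qed.

Lemma sub_normalizer x : x \in H -> x \in normalizer.
Proof.
move=> xH; apply/asboolP => h; apply/idP/idP => [hxH|hH]; last exact: gpredJ.
by rewrite -[h]conjg1 -(mulgV x) conjgM gpredJ // gpredV.
Qed.

Record norm_group := NormGroup {
  norm_val :> E;
  norm_mem : norm_val \in normalizer
}.

HB.instance Definition _ := [isSub for norm_val].
HB.instance Definition _ := [Choice of norm_group by <:].
HB.instance Definition _ :=
  SubChoice_isSubGroup.Build E normalizer norm_group normalizer_closed.

Lemma norm_valM (x y : norm_group) : norm_val (x * y) = norm_val x * norm_val y.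
Proof. by rewrite -[LHS]/(val (x * y)) gmulfM. Qed.

Lemma norm_val1 : norm_val 1 = 1.
Proof. by rewrite -[LHS]/(val 1) gmulf1. Qed.

Lemma norm_valV (x : norm_group) : norm_val x^-1 = (norm_val x)^-1.
Proof.
by apply: (mulgI (norm_val x)); rewrite -norm_valM !mulgV norm_val1.
Qed.

Lemma norm_valJ (x : norm_group) h : (h ^ norm_val x \in H) = (h \in H).
Proof. by have /asboolP := norm_mem x. Qed.

(* [x] and [y] are equivalent when [x H = y H]. *)
Definition coset_equiv : rel norm_group :=
  fun x y => (norm_val x)^-1 * norm_val y \in H.

Lemma coset_equiv_is_equiv : equiv_class_of coset_equiv.
Proof.
split=> [x|x y|y x z]; rewrite /coset_equiv.
- by rewrite mulVg gpred1.
- by rewrite -gpredV invgM invgK.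
move=> xy yz; rewrite -[norm_val z](mulVKg (norm_val y)) mulgA; exact: gpredM.
Qed.

Canonical coset_equiv_rel := EquivRelPack coset_equiv_is_equiv.

Definition norm_quot := {eq_quot coset_equiv}.
HB.instance Definition _ := EqQuotient.on norm_quot.
HB.instance Definition _ := Choice.on norm_quot.

Definition coset (x : norm_group) : norm_quot := \pi x.

Lemma coset_eq x y : coset x = coset y <-> coset_equiv x y.
Proof. by split=> [/eqP|xy]; last apply/eqP; rewrite eqmodE. Qed.

Lemma coset_repr c : coset (repr c) = c.
Proof. exact: reprK. Qed.

Definition coset_mul (c c' : norm_quot) := coset (repr c * repr c').
Definition coset_inv (c : norm_quot) := coset (repr c)^-1.

Lemma coset_mulE x y : coset_mul (coset x) (coset y) = coset (x * y).
Proof.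
have /coset_eq := coset_repr (coset x); have /coset_eq := coset_repr (coset y).
rewrite /coset_mul; set x' := repr (coset x); set y' := repr (coset y).
rewrite /coset_equiv => yH xH; apply/coset_eq; rewrite /coset_equiv !norm_valM.
suff -> : (norm_val x' * norm_val y')^-1 * (norm_val x * norm_val y) =
    ((norm_val x')^-1 * norm_val x) ^ norm_val y' * ((norm_val y')^-1 * norm_val y).
  by rewrite gpredM // norm_valJ.
by rewrite /conjg invgM -!mulgA mulVKg.
Qed.

Lemma coset_invE x : coset_inv (coset x) = coset x^-1.
Proof.
have /coset_eq := coset_repr (coset x); rewrite /coset_inv; set x' := repr _.
rewrite /coset_equiv => xH; apply/coset_eq; rewrite /coset_equiv !norm_valV invgK.
rewrite -(norm_valJ x') /conjg mulgA mulKg -gpredV invgM invgK.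
exact: xH.
Qed.

Lemma coset_ind (P : norm_quot -> Prop) :
  (forall x, P (coset x)) -> forall c, P c.
Proof. by move=> Px c; rewrite -(coset_repr c). Qed.

Lemma coset_mulA : associative coset_mul.
Proof.
elim/coset_ind=> x; elim/coset_ind=> y; elim/coset_ind=> z.
by rewrite !coset_mulE mulgA.
Qed.

Lemma coset_mul1 : left_id (coset 1) coset_mul.
Proof. by elim/coset_ind=> x; rewrite coset_mulE mul1g. Qed.

Lemma coset_1mul : right_id (coset 1) coset_mul.
Proof. by elim/coset_ind=> x; rewrite coset_mulE mulg1. Qed.

Lemma coset_mulV : left_inverse (coset 1) coset_inv coset_mul.
Proof. by elim/coset_ind=> x; rewrite coset_invE coset_mulE mulVg. Qed.

Lemma coset_Vmul : right_inverse (coset 1) coset_inv coset_mul.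
Proof. by elim/coset_ind=> x; rewrite coset_invE coset_mulE mulgV. Qed.

HB.instance Definition _ := isGroup.Build norm_quot
  coset_mulA coset_mul1 coset_1mul coset_mulV coset_Vmul.

Lemma cosetM x y : coset (x * y) = coset x * coset y.
Proof. by rewrite -coset_mulE. Qed.

Lemma cosetV x : coset x^-1 = (coset x)^-1.
Proof. by rewrite -coset_invE. Qed.
End NormalizerQuotient.
Arguments coset {E H} x.

Section NormalizerQuotientConjugation.
Variables (E : groupType) (H H' : groupClosed E) (u : E).
Hypothesis uHH' : forall h, (h ^ u \in H') = (h \in H).

Lemma conj_norm_subproof (x : norm_group H) :
  norm_val x ^ u \in normalizer H'.
Proof.
apply/asboolP => h.
have -> : h ^ (norm_val x ^ u) = ((h ^ u^-1) ^ norm_val x) ^ u.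
  by rewrite -!conjgM /conjg !invgM invgK !mulgA.
by rewrite uHH' norm_valJ -uHH' -conjgM mulVg conjg1.
Qed.

Definition conj_norm x := NormGroup (conj_norm_subproof x).

Definition coset_conj (c : norm_quot H) : norm_quot H' :=
  coset (conj_norm (repr c)).

Lemma coset_conjE x : coset_conj (coset x) = coset (conj_norm x).
Proof.
apply/coset_eq; rewrite /coset_equiv /= -conjVg -conjMg uHH'.
by apply/coset_eq; rewrite coset_repr.
Qed.

Lemma coset_conjM : {morph coset_conj : x y / x * y}.
Proof.
elim/coset_ind=> x; elim/coset_ind=> y.
rewrite -cosetM !coset_conjE -cosetM; congr coset; apply: val_inj.
by rewrite [RHS]norm_valM /= -conjMg -norm_valM.
Qed.

HB.instance Definition _ :=
  isMultiplicative.Build (norm_quot H) (norm_quot H') coset_conj coset_conjM.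
End NormalizerQuotientConjugation.

Record short_exact (N G Q : groupType) := ShortExact {
  inc : {multiplicative N -> G};
  pr : {multiplicative G -> Q};
  inc_inj : injective inc;
  pr_exact : forall g, pr g = 1 <-> exists n, g = inc n;
  pr_surj : forall q, exists g, pr g = q
}.

Section ShortExact.
Variables (N G Q : groupType) (E : short_exact N G Q).

(* [N] is regarded as a normal subgroup of [G] by means of [inc E], and
   [conjN g n] is the element [g^-1 n g] of [N]. *)
Lemma conjN_ex g n : exists n', inc E n ^ g = inc E n'.
Proof.
have [_ nN] := pr_exact E (inc E n); have {}nN := nN (ex_intro _ n erefl).
by apply/(pr_exact E); rewrite /conjg !gmulfM nN mul1g -gmulfM mulVg morph1.
Qed.

Definition conjN g n : N := sval (cid (conjN_ex g n)).

Lemma conjNE g n : inc E (conjN g n) = inc E n ^ g.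
Proof. by rewrite /conjN; case: cid => /=. Qed.

Lemma conjNM g n n' : conjN g (n * n') = conjN g n * conjN g n'.
Proof. by apply: (inc_inj (s := E)); rewrite !(gmulfM, conjNE) conjMg. Qed.

Lemma conjN1 n : conjN 1 n = n.
Proof. by apply: (inc_inj (s := E)); rewrite conjNE conjg1. Qed.

Lemma conjNJ g h n : conjN h (conjN g n) = conjN (g * h) n.
Proof. by apply: (inc_inj (s := E)); rewrite !conjNE conjgM. Qed.

Lemma conjN_inc n' n : conjN (inc E n') n = n ^ n'.
Proof. by apply: (inc_inj (s := E)); rewrite conjNE /conjg !gmulfM morphV. Qed.

(* A set-theoretic lift, only used to define operations induced on quotients
   by [pr E]; they are shown not to depend on it. *)
Definition lift (q : Q) : G := sval (cid (pr_surj E q)).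

Lemma liftK : cancel lift (pr E).
Proof. by move=> q; apply: svalP (cid (pr_surj E q)). Qed.

Lemma pr_inc n : pr E (inc E n) = 1.
Proof. by apply/(pr_exact E); exists n. Qed.

Lemma lift_pr g : exists n, g = lift (pr E g) * inc E n.
Proof.
have /(pr_exact E)[n gn] : pr E ((lift (pr E g))^-1 * g) = 1.
  by rewrite gmulfM morphV liftK mulVg.
by exists n; rewrite -gn mulVKg.
Qed.

Variable M : gmodType G.

Definition Ninv_pred : {pred M} := fun m => `[< forall n, inc E n *> m = m >].

Lemma Ninv_closed : zmod_closed Ninv_pred.
Proof.
split=> [|m m' /asboolP mN /asboolP m'N]; apply/asboolP => n.
  by rewrite gact0.
by rewrite gactB mN m'N.
Qed.

HB.instance Definition _ := GRing.isZmodClosed.Build M Ninv_pred Ninv_closed.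

Record Ninv := NInv { Ninv_val :> M; Ninv_mem : Ninv_val \in Ninv_pred }.

HB.instance Definition _ := [isSub for Ninv_val].
HB.instance Definition _ := [Choice of Ninv by <:].
HB.instance Definition _ := [SubChoice_isSubZmodule of Ninv by <:].

Lemma NinvP (m : Ninv) n : inc E n *> (m : M) = m.
Proof. by have /asboolP := Ninv_mem m. Qed.

Lemma Ninv_act_subproof g (m : Ninv) : g *> (m : M) \in Ninv_pred.
Proof.
apply/asboolP => n; rewrite -gactM.
have -> : inc E n * g = g * inc E (conjN g n).
  by rewrite conjNE /conjg mulgA mulgV mul1g.
by rewrite gactM NinvP.
Qed.

Definition Ninv_act (q : Q) (m : Ninv) : Ninv :=
  NInv (Ninv_act_subproof (lift q) m).

Lemma Ninv_actE g m : Ninv_act (pr E g) m = g *> (m : M) :> M.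
Proof.
by have [n {2}->] := lift_pr g; rewrite gactM NinvP.
Qed.

Lemma Ninv_act1 m : Ninv_act 1 m = m.
Proof.
by apply: val_inj; rewrite -(morph1 (pr E)) [LHS]Ninv_actE gact1.
Qed.

Lemma Ninv_actM q q' m : Ninv_act (q * q') m = Ninv_act q (Ninv_act q' m).
Proof.
apply: val_inj; rewrite -(liftK q) -(liftK q') -gmulfM [LHS]Ninv_actE.
by rewrite [RHS]Ninv_actE Ninv_actE gactM.
Qed.

Lemma Ninv_valD (m m' : Ninv) : Ninv_val (m + m') = Ninv_val m + Ninv_val m'.
Proof. by rewrite -[LHS]/(val _) raddfD. Qed.

Lemma Ninv_actD q m m' : Ninv_act q (m + m') = Ninv_act q m + Ninv_act q m'.
Proof.
by apply: val_inj; rewrite [RHS]Ninv_valD -gactD -Ninv_valD.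
Qed.

HB.instance Definition _ :=
  isGModule.Build Q Ninv Ninv_act1 Ninv_actM Ninv_actD.

Lemma Ninv_gactE g (m : Ninv) : Ninv_val (pr E g *> m) = g *> Ninv_val m.
Proof. exact: Ninv_actE. Qed.

Definition is_der (d : N -> M) : Prop :=
  forall n n', d (n * n') = d n + inc E n *> d n'.

Definition der_pred : {pred N -> M} := fun d => `[< is_der d >].

Lemma der_closed : zmod_closed der_pred.
Proof.
split=> [|d d' /asboolP dD /asboolP d'D]; apply/asboolP => n n'.
  by rewrite gact0 addr0.
by rewrite !fctE dD d'D gactB opprD addrACA.
Qed.

HB.instance Definition _ := GRing.isZmodClosed.Build (N -> M) der_pred der_closed.

Record Der := MkDer { der_fun :> N -> M; der_mem : der_fun \in der_pred }.

HB.instance Definition _ := [isSub for der_fun].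
HB.instance Definition _ := [Choice of Der by <:].
HB.instance Definition _ := [SubChoice_isSubZmodule of Der by <:].

Lemma derP (d : Der) : is_der d.
Proof. by apply/asboolP/der_mem. Qed.

Lemma der_ext (d d' : Der) : d =1 d' -> d = d'.
Proof. by move=> dd'; apply/val_inj/funext. Qed.

Lemma derB (d d' : Der) n : (d - d') n = d n - d' n.
Proof. by rewrite -[der_fun _]/(val _) raddfB. Qed.

Lemma derD (d d' : Der) n : (d + d') n = d n + d' n.
Proof. by rewrite -[der_fun _]/(val _) raddfD. Qed.

Lemma der1 (d : Der) : d 1 = 0.
Proof. by apply: (addrI (d 1)); rewrite -{2}(gact1 (d 1)) -(morph1 (inc E)) -derP mulg1 addr0. Qed.

Definition is_inner (d : N -> M) : Prop :=
  exists m, forall n, d n = inc E n *> m - m.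

Definition Inn : {pred Der} := fun d => `[< is_inner d >].

Lemma Inn_closed : zmod_closed Inn.
Proof.
split=> [|d d' /asboolP[m dm] /asboolP[m' d'm]]; apply/asboolP.
  by exists 0 => n; rewrite gact0 subr0.
by exists (m - m') => n; rewrite derB dm d'm gactB !opprD addrACA.
Qed.

HB.instance Definition _ := GRing.isZmodClosed.Build Der Inn Inn_closed.

Definition H1 := {ideal_quot Inn}.
HB.instance Definition _ := GRing.Zmodule.on H1.

Definition H1class (d : Der) : H1 := \pi d.

Lemma H1class_eq (d d' : Der) : H1class d = H1class d' <-> is_inner (d - d').
Proof.
split=> [/eqP|] dd'; last apply/eqP; move: dd'; rewrite -Quotient.idealrBE.
  by move/asboolP.
by move=> dd'; apply/asboolP.
Qed.

Lemma H1class_repr c : H1class (repr c) = c.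
Proof. exact: reprK. Qed.

Lemma H1classD d d' : H1class (d + d') = H1class d + H1class d'.
Proof. by rewrite /H1class raddfD. Qed.

Lemma der_act_subproof g (d : Der) : (fun n => g *> d (conjN g n)) \in der_pred.
Proof.
apply/asboolP => n n'; rewrite conjNM derP gactD; congr (_ + _).
by rewrite -!gactM conjNE /conjg mulgA mulgA mulgV mul1g.
Qed.

Definition der_act g d : Der := MkDer (der_act_subproof g d).

Lemma der_actE g d n : der_act g d n = g *> d (conjN g n).
Proof. by []. Qed.

Lemma der_act1 d : der_act 1 d = d.
Proof. by apply: der_ext => n; rewrite der_actE gact1 conjN1. Qed.

Lemma der_actM g h d : der_act (g * h) d = der_act g (der_act h d).
Proof. by apply: der_ext => n; rewrite !der_actE gactM conjNJ. Qed.

Lemma der_actD g d d' : der_act g (d + d') = der_act g d + der_act g d'.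
Proof. by apply: der_ext => n; rewrite derD !der_actE derD gactD. Qed.

HB.instance Definition _ := isGModule.Build G Der der_act1 der_actM der_actD.

Lemma gact_derE g (d : Der) n : (g *> d) n = g *> d (conjN g n).
Proof. by []. Qed.

Lemma H1class_act g d d' :
  H1class d = H1class d' -> H1class (g *> d) = H1class (g *> d').
Proof.
move=> /H1class_eq[m dd']; apply/H1class_eq; exists (g *> m) => n.
rewrite -gactB gact_derE dd' gactB -!gactM; congr (_ *> _ - _).
by rewrite conjNE /conjg mulgA mulgV mul1g.
Qed.

Lemma H1class_inc n d : H1class (inc E n *> d) = H1class d.
Proof.
apply/H1class_eq; exists (d n) => x.
rewrite derB gact_derE conjN_inc /conjg !derP !gactD -!gactM !(=^~ gmulfM).
rewrite !(mulgA, mulgV) mul1g morph1 gact1.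
have -> : inc E n *> d n^-1 = - d n.
  by apply: (addrI (d n)); rewrite -derP mulgV der1 subrr.
by rewrite -addrA [_ + _ - _]addrAC subrr add0r addrC.
Qed.

(* The action of [Q] on [H^1(N, M)] induced by that of [G] on derivations; it
   is characterized by [H1_gactE]. *)
Definition H1_act (q : Q) (c : H1) : H1 := H1class (lift q *> repr c).

Lemma H1_actE g d : H1_act (pr E g) (H1class d) = H1class (g *> d).
Proof.
have [n {2}->] := lift_pr g; rewrite gactM; apply: H1class_act.
by rewrite H1class_inc H1class_repr.
Qed.

Lemma H1_act1 c : H1_act 1 c = c.
Proof. by rewrite -(H1class_repr c) -(morph1 (pr E)) H1_actE gact1. Qed.

Lemma H1_actM q q' c : H1_act (q * q') c = H1_act q (H1_act q' c).
Proof.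
rewrite -(H1class_repr c) -(liftK q) -(liftK q') -gmulfM !H1_actE.
by rewrite gactM.
Qed.

Lemma H1_actD q c c' : H1_act q (c + c') = H1_act q c + H1_act q c'.
Proof.
rewrite -(H1class_repr c) -(H1class_repr c') -(liftK q) -H1classD !H1_actE.
by rewrite gactD H1classD.
Qed.

HB.instance Definition _ := isGModule.Build Q H1 H1_act1 H1_actM H1_actD.

Lemma H1_gactE g d : pr E g *> H1class d = H1class (g *> d).
Proof. exact: H1_actE. Qed.

Definition H1inv := {c : H1 | forall q : Q, q *> c = c}.

Lemma H1inv_inner d : (forall q : Q, q *> H1class d = H1class d) ->
  forall g, is_inner (g *> d - d).
Proof. by move=> dQ g; apply/H1class_eq; rewrite -H1_gactE; apply: dQ. Qed.
End ShortExact.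

Section SemidirectProduct.
Variables (G : groupType) (M : gmodType G).

Definition sdprod := (M * G)%type.
HB.instance Definition _ := Choice.on sdprod.
Implicit Types x y z : sdprod.

Definition sd_mul x y : sdprod := (x.1 + x.2 *> y.1, x.2 * y.2).
Definition sd_one : sdprod := (0, 1).
Definition sd_inv x : sdprod := (- (x.2^-1 *> x.1), x.2^-1).

Lemma sd_mulA : associative sd_mul.
Proof. by move=> x y z; rewrite /sd_mul /= gactD gactM addrA mulgA. Qed.

Lemma sd_mul1 : left_id sd_one sd_mul.
Proof. by case=> m g; rewrite /sd_mul /= gact1 add0r mul1g. Qed.

Lemma sd_1mul : right_id sd_one sd_mul.
Proof. by case=> m g; rewrite /sd_mul /= gact0 addr0 mulg1. Qed.

Lemma sd_mulV : left_inverse sd_one sd_inv sd_mul.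
Proof. by case=> m g; rewrite /sd_mul /= addNr mulVg. Qed.

Lemma sd_Vmul : right_inverse sd_one sd_inv sd_mul.
Proof. by case=> m g; rewrite /sd_mul /= gactN gactVK subrr mulgV. Qed.

HB.instance Definition _ :=
  isGroup.Build sdprod sd_mulA sd_mul1 sd_1mul sd_mulV sd_Vmul.

Lemma sd_mulE (m m' : M) (g g' : G) :
  ((m, g) : sdprod) * (m', g') = (m + g *> m', g * g').
Proof. by []. Qed.

Lemma sd_invE (m : M) (g : G) :
  ((m, g) : sdprod)^-1 = (- (g^-1 *> m), g^-1).
Proof. by []. Qed.

Lemma sd_conjE (a m : M) (k g : G) :
  ((a, k) : sdprod) ^ (m, g) = (g^-1 *> (a + k *> m - m), k ^ g).
Proof.
by rewrite /conjg sd_invE !sd_mulE addrC -gactB.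
Qed.
End SemidirectProduct.

Section Transgression.
Variables (N G Q : groupType) (E : short_exact N G Q) (M : gmodType G).

Section Graph.
Variable d : Der E M.

(* The subgroup [H = {(d(n), n) | n in N}] of the semidirect product. *)
Definition der_graph : {pred sdprod M} :=
  fun x => `[< exists n, x = (d n, inc E n) >].

Lemma der_graphP x : reflect (exists n, x = (d n, inc E n)) (x \in der_graph).
Proof. exact: asboolP. Qed.

Lemma der_graph1 : 1 \in der_graph.
Proof. by apply/der_graphP; exists 1; rewrite der1 morph1. Qed.

Lemma der_graphM : mulg_closed der_graph.
Proof.
move=> _ _ /der_graphP[n ->] /der_graphP[n' ->]; apply/der_graphP.
by exists (n * n'); rewrite sd_mulE derP gmulfM.
Qed.

Lemma der_inv n : d n^-1 = - (inc E n^-1 *> d n).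
Proof.
apply: (addrI (inc E n^-1 *> d n)); rewrite subrr addrC.
by rewrite -derP mulVg der1.
Qed.

Lemma der_graphV : invg_closed der_graph.
Proof.
move=> _ /der_graphP[n ->]; apply/der_graphP; exists n^-1.
by rewrite sd_invE der_inv morphV.
Qed.

HB.instance Definition _ := isMulClosed.Build (sdprod M) der_graph der_graphM.
HB.instance Definition _ := isMul1Closed.Build (sdprod M) der_graph der_graph1.
HB.instance Definition _ := isInvClosed.Build (sdprod M) der_graph der_graphV.

Lemma der_graph_inc (m : M) n :
  ((m, inc E n) : sdprod M) \in der_graph <-> m = d n.
Proof.
split=> [/der_graphP[n' [-> /(@inc_inj _ _ _ E) ->]] // | ->].
by apply/der_graphP; exists n.
Qed.

Lemma der_graph_norm (m : M) (g : G) :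
  ((m, g) : sdprod M) \in normalizer der_graph <->
  forall n, (g *> d - d) n = inc E n *> m - m.
Proof.
have graphJ (a : M) n : ((a, inc E n) : sdprod M) ^ (m, g) \in der_graph <->
    a + inc E n *> m - m = g *> d (conjN E g n).
  rewrite sd_conjE -conjNE der_graph_inc.
  by split=> [<-|->]; rewrite ?gactVK ?gactK.
split=> [/asboolP mgN n | mgd].
  have /graphJ : ((d n, inc E n) : sdprod M) ^ (m, g) \in der_graph.
    by rewrite mgN; apply/der_graph_inc.
  rewrite derB gact_derE => <-.
  by rewrite -(addrA (d n)) addrAC subrr add0r.
have {mgd}dE n : d n + inc E n *> m - m = g *> d (conjN E g n).
  by rewrite -gact_derE -addrA -mgd derB addrCA subrr addr0.
apply/asboolP => -[a k]; apply/idP/idP => [|/der_graphP[n [-> ->]]].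
  rewrite {1}sd_conjE => /der_graphP[n' [akd kn']].
  have kE : k = inc E (conjN E g^-1 n').
    by rewrite conjNE -kn' -conjgM mulgV conjg1.
  apply/der_graphP; exists (conjN E g^-1 n'); rewrite -kE; congr pair.
  apply/(addIr (inc E (conjN E g^-1 n') *> m - m)); rewrite !addrA dE.
  by rewrite conjNJ mulVg conjN1 -akd gactVK -kE.
exact/graphJ.
Qed.
End Graph.

Section Extension.
Variables (d : Der E M) (dQ : forall q : Q, q *> H1class d = H1class d).

Notation NH := (norm_group (der_graph d)).

Lemma tr_i_subproof (m : Ninv E M) :
  ((m : M, 1) : sdprod M) \in normalizer (der_graph d).
Proof.
by apply/der_graph_norm => n; rewrite derB gact1 !subrr NinvP subrr.
Qed.

Definition tr_i (m : Ninv E M) : norm_quot (der_graph d) :=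
  coset (NormGroup (tr_i_subproof m)).

Lemma pr_coset (x y : NH) :
  coset x = coset y -> pr E (norm_val x).2 = pr E (norm_val y).2.
Proof.
move=> /coset_eq/der_graphP[n [_ xy]]; apply: (mulgI (pr E (norm_val x).2)^-1).
by rewrite mulVg -morphV -gmulfM xy pr_inc.
Qed.

Definition tr_p (c : norm_quot (der_graph d)) : Q := pr E (norm_val (repr c)).2.

Lemma tr_pE x : tr_p (coset x) = pr E (norm_val x).2.
Proof. by apply: pr_coset; rewrite coset_repr. Qed.

Lemma tr_pM : {morph tr_p : x y / x * y}.
Proof.
elim/coset_ind=> x; elim/coset_ind=> y.
by rewrite -cosetM !tr_pE norm_valM gmulfM.
Qed.

HB.instance Definition _ :=
  isMultiplicative.Build (norm_quot (der_graph d)) Q tr_p tr_pM.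

Lemma tr_iD m m' : tr_i (m + m') = tr_i m * tr_i m'.
Proof.
rewrite -cosetM; congr coset; apply: val_inj.
by rewrite [RHS]norm_valM /= sd_mulE gact1 mulg1 -Ninv_valD.
Qed.

Lemma tr_i_inj : injective tr_i.
Proof.
move=> m m' /coset_eq; rewrite /coset_equiv /= sd_invE sd_mulE.
rewrite invg1 mul1g -(morph1 (inc E)) => /der_graph_inc.
rewrite der1 morph1 !gact1 addrC => /eqP; rewrite subr_eq0 => /eqP mm'.
exact/esym/val_inj.
Qed.

Lemma tr_exact x : tr_p x = 1 <-> exists m, x = tr_i m.
Proof.
split=> [|[m ->]]; last by rewrite tr_pE morph1.
elim/coset_ind: x => x; rewrite tr_pE => /(pr_exact E)[n].
case: x => -[m g] mgN /= gn; rewrite {}gn in mgN *.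
set x := NormGroup _.
have hN : ((d n, inc E n) : sdprod M) \in normalizer (der_graph d).
  by apply/sub_normalizer/der_graph_inc.
pose y : NH := x * (NormGroup hN)^-1.
have yE : norm_val y = (m - d n, 1).
  rewrite norm_valM norm_valV /= sd_invE sd_mulE mulgV.
  by rewrite gactN gactVK.
have mdN : m - d n \in @Ninv_pred _ _ _ E M.
  apply/asboolP => n'; apply/eqP; rewrite -subr_eq0; apply/eqP.
  have := norm_mem y; rewrite yE => /der_graph_norm <-.
  by rewrite derB gact1 subrr.
exists (NInv mdN); have -> : x = y * NormGroup hN by rewrite mulgVK.
apply/coset_eq; rewrite /coset_equiv norm_valM yE invgM mulgVK gpredV.
exact/der_graph_inc.
Qed.

Lemma tr_p_surj q : exists x, tr_p x = q.
Proof.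
have [g <-] := pr_surj E q; have [m gd] := H1inv_inner dQ g.
have mgN : ((m, g) : sdprod M) \in normalizer (der_graph d).
  exact/der_graph_norm.
by exists (coset (NormGroup mgN)); rewrite tr_pE.
Qed.

Lemma tr_act x m : tr_i (tr_p x *> m) = x * tr_i m * x^-1.
Proof.
elim/coset_ind: x => x; rewrite tr_pE.
transitivity (coset (x * NormGroup (tr_i_subproof m) * x^-1)); last first.
  by rewrite !cosetM cosetV.
congr coset; apply: val_inj; rewrite [RHS]norm_valM norm_valM norm_valV.
transitivity (Ninv_val (pr E (norm_val x).2 *> m), 1 : G) => //.
rewrite Ninv_gactE /=; case: (norm_val x) => a g.
rewrite sd_invE !sd_mulE /= mulg1 mulgV.
by rewrite gactN gactVK addrC addrA addNr add0r.
Qed.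

Definition tr_extension : extension (Ninv E M) :=
  Extension tr_iD tr_i_inj tr_exact tr_p_surj tr_act.
End Extension.

Lemma tr_extension_class (d d' : Der E M)
    (dQ : forall q : Q, q *> H1class d = H1class d)
    (d'Q : forall q : Q, q *> H1class d' = H1class d') :
  H1class d' = H1class d ->
  ext_class (tr_extension d'Q) = ext_class (tr_extension dQ).
Proof.
move=> /H1class_eq[m dd']; pose u : sdprod M := (m, 1).
have uE (a : M) (k : G) : ((a, k) : sdprod M) ^ u = (a + k *> m - m, k).
  by rewrite sd_conjE invg1 gact1 conjg1.
have d'E n : d' n = d n + inc E n *> m - m.
  by rewrite -addrA -dd' derB addrCA subrr addr0.
have uH h : (h ^ u \in der_graph d') = (h \in der_graph d).
  case: h => a k; rewrite uE.
  apply/idP/idP => /der_graphP[n [aE kE]]; rewrite kE in aE *; apply/der_graph_inc; last first.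
    by rewrite aE d'E.
  by move: aE; rewrite d'E => /addIr/addIr.
pose phi : {multiplicative norm_quot (der_graph d) -> norm_quot (der_graph d')}
  := coset_conj uH.
apply/esym/(@ext_class_equiv _ _ (tr_extension dQ) (tr_extension d'Q) phi).
  move=> a.
  rewrite [LHS]coset_conjE; congr coset; apply: val_inj.
  by rewrite [LHS]uE gact1 addrK.
elim/coset_ind=> x; rewrite [phi _]coset_conjE [LHS]tr_pE [RHS]tr_pE /=.
by rewrite invg1 mul1g mulg1.
Qed.

(* [tr c] is the class of the extension associated with a representative of
   [c]; it does not depend on it by [trE]. *)
Lemma tr_repr (c : H1inv E M) (q : Q) :
  q *> H1class (repr (sval c)) = H1class (repr (sval c)).
Proof. by rewrite H1class_repr; apply: (svalP c). Qed.

Definition tr (c : H1inv E M) : H2 (Ninv E M) :=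
  ext_class (tr_extension (tr_repr c)).

Lemma trE (d : Der E M) (dQ : forall q : Q, q *> H1class d = H1class d) :
  tr (exist _ (H1class d) dQ) = ext_class (tr_extension dQ).
Proof. by apply: tr_extension_class; rewrite H1class_repr. Qed.
End Transgression.

(* Main.v *)
Require Import Defs.
From HB Require Import structures.
From mathcomp Require Import all_boot all_algebra.

Set Implicit Arguments.
Unset Strict Implicit.
Unset Printing Implicit Defensive.

Import GRing.Theory.

Local Open Scope ring_scope.
Local Open Scope group_scope.

(** The hypothesis on [eta] says exactly that each pair [(eta q, alpha q)]
    normalizes the graph [H] of [d] (this is [der_graph_norm]), so that
    [q |-> (eta q, alpha q) H] is a section of the extension defining the
    transgression of the class of [d].  As the class of an extension does not
    depend on the section ([ext_classE]), it remains to compute the cocycle [F]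
    of this section.  By its definition, [(eta q1, alpha q1) (eta q2, alpha q2)]
    and [(F q1 q2, 1) (eta (q1 q2), alpha (q1 q2))] have the same coset modulo
    [H]; as [H] is normal in its normalizer they differ by a left factor
    [(d n, n)] in [H].  Comparing components in [G] forces [n = f q1 q2], and
    comparing components in [M], where [n] fixes [F q1 q2], gives the formula
    ([tr_cocycleE]). *)

(** Cosets are defined by division on the left; in the semidirect product the
    comparison is simpler with the element of [H] as a left factor, which is
    harmless because [H] is normal in its normalizer. *)
Lemma coset_eq_left (E : groupType) (H : groupClosed E) (x y : norm_group H) :
  coset x = coset y -> exists2 h, h \in H & norm_val x = h * norm_val y.
Proof.
move=> /coset_eq xyH; exists (norm_val x * (norm_val y)^-1); last first.
  by rewrite mulgVK.
by rewrite -gpredV invgM invgK -(norm_valJ x) /conjg mulgVK.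
Qed.

Section TransgressionCocycle.
Variables (N G Q : groupType) (E : short_exact N G Q) (M : gmodType G).
Variables (alpha : Q -> G) (f : Q -> Q -> N).
Hypothesis alphaK : forall q : Q, pr E (alpha q) = q.
Hypothesis alphaM : forall q q' : Q,
  alpha q * alpha q' = inc E (f q q') * alpha (q * q').
Variables (d : Der E M) (dQ : forall q : Q, q *> H1class d = H1class d).
Variable eta : Q -> M.
Hypothesis etaE : forall (q : Q) (n : N),
  (alpha q *> d - d) n = inc E n *> eta q - eta q.

Lemma eta_alpha_norm q :
  ((eta q, alpha q) : sdprod M) \in normalizer (der_graph d).
Proof. by apply/der_graph_norm; apply: etaE. Qed.

Definition tr_section (q : Q) : ext_group (tr_extension dQ) :=
  coset (NormGroup (eta_alpha_norm q)).

Lemma tr_sectionK : cancel tr_section (ext_p (tr_extension dQ)).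
Proof. by move=> q; rewrite [LHS]tr_pE /= alphaK. Qed.

Lemma tr_cocycleE (q1 q2 : Q) :
  Ninv_val (ext_cocycle tr_sectionK q1 q2) =
    eta q1 + alpha q1 *> eta q2 - inc E (f q1 q2) *> eta (q1 * q2)
    - d (f q1 q2).
Proof.
have := ext_cocycle_funE tr_sectionK q1 q2.
change (Ninv_val (ext_cocycle tr_sectionK q1 q2))
  with (Ninv_val (ext_cocycle_fun tr_sectionK q1 q2)).
move: (ext_cocycle_fun _ q1 q2) => F.
rewrite -[LHS]cosetM -[RHS]cosetM => /coset_eq_left[_ /der_graphP[n ->]].
rewrite !norm_valM /= !sd_mulE gact1 mul1g => -[ME].
rewrite alphaM => /mulIg/inc_inj fE.
by rewrite ME fE gactD NinvP addrA addrK addrAC subrr add0r.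
Qed.
End TransgressionCocycle.

Theorem mainTheorem4 (N G Q : groupType) (E : short_exact N G Q)
    (M : gmodType G) (alpha : Q -> G) (f : Q -> Q -> N)
    (alphaK : forall q : Q, pr E (alpha q) = q)
    (alphaM : forall q q' : Q,
      alpha q * alpha q' = inc E (f q q') * alpha (q * q'))
    (d : Der E M) (dQ : forall q : Q, q *> H1class d = H1class d)
    (eta : Q -> M) (eta1 : eta 1 = 0)
    (etaE : forall (q : Q) (n : N),
      (alpha q *> d - d) n = inc E n *> eta q - eta q) :
  exists F : cocycle2 (Ninv E M),
    (forall q1 q2 : Q,
      Ninv_val (F q1 q2) =
        eta q1 + alpha q1 *> eta q2 - inc E (f q1 q2) *> eta (q1 * q2)
        - d (f q1 q2)) /\
    tr (exist _ (H1class d) dQ) = H2class F.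
Proof.
exists (ext_cocycle (tr_sectionK alphaK dQ etaE)).
split; first by move=> q1 q2; apply: tr_cocycleE.
by rewrite trE; apply: ext_classE.
Qed.
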